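(* An infinite group $G$ is $\mathfrak{Z}_{mon}$-cofinite if and only if either $G$ has prime exponent, or $G$ satisfies the Weak Cancellation Law (WCL).
   Context: For a group $G$ with neutral element $e$, the monomial topology $\mathfrak{Z}_{mon,G}$ is the topology on $G$ having as a subbase of its closed sets the family of all sets $\{x\in G : g x^n = e\}$ with $g\in G$, $n\in\mathbb{N}$. The group $G$ is called $\mathfrak{Z}_{mon}$-cofinite if $\mathfrak{Z}_{mon,G}$ is the cofinite topology on $G$ (whose closed sets are exactly $G$ and the finite subsets of $G$). A group $G$ satisfies WCL if for every integer $n>0$ the map $x\mapsto x^n$, $G\to G$, is finitely-many-to-one, i.e. every fiber is finite. The exponent of $G$ is the smallest positive integer $m$ (if it exists) with $x^m=e$ for all $x\in G$; $G$ has prime exponent if its exponent exists and is a prime number. *)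

(* Defs.v *)
From HB Require Import structures.
From mathcomp Require Import all_boot.
From mathcomp Require Import all_classical.
From mathcomp Require Import topology.

Set Implicit Arguments.
Unset Strict Implicit.
Unset Printing Implicit Defensive.

Local Open Scope classical_set_scope.
Local Open Scope group_scope.

(* Here n ranges over all of nat; the sets with n = 0 are only G and the empty
   set, so they do not affect the topology. *)
Definition elementary_monomial (G : groupType) : set (set G) :=
  [set A | exists (g : G) (n : nat), A = [set x : G | g * x ^+ n = 1]].

(* Copy of G that carries the topology Z_mon. *)
Definition monomial_space (G : groupType) : Type := G.

HB.instance Definition _ (G : groupType) := Choice.copy (monomial_space G) G.

(* The library factory takes a subbase of open sets, so it is given the
   complements of the elementary monomial sets. *)
HB.instance Definition _ (G : groupType) :=
  isSubBaseTopological.Build (monomial_space G)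
    [set U : set (monomial_space G) | elementary_monomial (~` U)] id.

Definition cofinite_topology (T : topologicalType) : Prop :=
  forall A : set T, closed A <-> A = [set: T] \/ finite_set A.

Definition Zmon_cofinite (G : groupType) : Prop :=
  cofinite_topology (monomial_space G).

Definition WCL (G : groupType) : Prop :=
  forall n : nat, (0 < n)%N -> forall y : G, finite_set [set x : G | x ^+ n = y].

Definition is_exponent (G : groupType) (m : nat) : Prop :=
  [/\ (0 < m)%N, forall x : G, x ^+ m = 1 &
      forall k : nat, (0 < k)%N -> (forall x : G, x ^+ k = 1) -> (m <= k)%N].

Definition prime_exponent (G : groupType) : Prop :=
  exists2 m : nat, is_exponent G m & prime m.

(* Main.v *)
Require Import Defs.
From mathcomp Require Import all_boot finmap.
From mathcomp Require Import all_classical.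
From mathcomp Require Import topology.

(** The equation [g * x ^+ n = 1] says that [x ^+ n = g^-1], so the elementary
    monomial sets are the fibers of the power maps [x |-> x ^+ n].  Fibers are
    closed, so in a cofinite topology each of them is finite or the whole group.
    Those with [n = 1] are the singletons, which makes finite sets closed, and
    if every fiber is finite or the whole group then nothing else is closed
    ([Zmon_cofiniteP]).  The theorem is then about fibers of power maps.

    Since [1 ^+ n = 1], a fiber that is the whole group is the fiber over [1], and
    then [n] annihilates [G].  So under the fiber condition an infinite fiber of
    a positive power [n] says that [n] annihilates [G].  If WCL fails there is such
    an [n], and [G] has an exponent [m].  A factorization [m = a * b] into
    proper factors would make [x |-> x ^+ a] a map from the infinite group [G]
    to the solutions of [y ^+ b = 1], which are finitely many because [b < m]
    does not annihilate [G]; one fiber of that map would be infinite, and [a < m]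
    would annihilate [G].  Hence [m] is prime.

    Conversely, WCL makes all fibers of positive powers finite, and in prime
    exponent [p] a power map is either trivial, when [p] divides [n], or
    injective, because [n] is invertible modulo [p]. *)

Set Implicit Arguments.
Unset Strict Implicit.
Unset Printing Implicit Defensive.

Local Open Scope classical_set_scope.
Local Open Scope group_scope.

Definition power_fiber (G : groupType) (n : nat) (y : G) : set G :=
  [set x : G | x ^+ n = y].

Definition power_fibers_finite_or_full (G : groupType) : Prop :=
  forall (n : nat) (y : G),
    power_fiber n y = [set: G] \/ finite_set (power_fiber n y).

Lemma elementary_monomialP (G : groupType) (A : set G) :
  elementary_monomial A <-> exists n y, A = power_fiber n y.
Proof.
have fiberE (g : G) n : [set x : G | g * x ^+ n = 1] = power_fiber n g^-1.
  apply/seteqP; split=> x /=; first by move/mulg1_eq.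
  by rewrite /power_fiber /= => ->; rewrite mulgV.
split=> [[g [n ->]]|[n [y ->]]]; first by exists n, g^-1.
by exists y^-1, n; rewrite fiberE invgK.
Qed.

Lemma closed_power_fiber (G : groupType) (n : nat) (y : G) :
  closed (power_fiber n y : set (monomial_space G)).
Proof.
rewrite -openC.
(* A subbasic open set is the union of the family whose only member is the
   intersection of that one set. *)
exists [set ~` power_fiber n y]; last by rewrite bigcup_set1.
move=> _ ->; apply: finI_from1 => /=.
by rewrite setCK; apply/elementary_monomialP; exists n, y.
Qed.

Lemma power_fiber1 (G : groupType) (y : G) : power_fiber 1 y = [set y].
Proof. by apply/seteqP; split=> x /=; rewrite /power_fiber /= expg1. Qed.

Lemma finite_closed (G : groupType) (A : set (monomial_space G)) :
  finite_set A -> closed A.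
Proof.
move=> finA; rewrite -(image_id A) -bigcup_imset1.
apply: closed_bigcup => // y _.
by rewrite -power_fiber1; apply: closed_power_fiber.
Qed.

Lemma open_monomial_basis (G : groupType) (U : set (monomial_space G)) (x : G) :
  open U -> U x ->
  exists C : set (set G), [/\ finite_set C,
    forall V, C V -> elementary_monomial (~` V),
    (\bigcap_(V in C) V) x & \bigcap_(V in C) V `<=` U].
Proof.
move=> [B subB <-] [W BW Wx].
pose subbase : set (set G) := [set V | elementary_monomial (~` V)].
have [F subF defW] : finI_from subbase id W by exact: subB BW.
exists [set` F]; split.
- exact: finite_fset.
- by move=> V FV; have /set_mem := subF V FV.
- by rewrite -defW in Wx.
- by move=> z Fz; exists W => //; rewrite -defW.
Qed.

(** Around a point outside a closed set [A] there is a basic open set avoiding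
    [A]; its complement is a finite union of power fibers.  Each of these fibers
    misses the point, hence is finite, and together they cover [A]. *)
Lemma closed_full_or_finite (G : groupType) (A : set (monomial_space G)) :
  power_fibers_finite_or_full G -> closed A -> A = [set: _] \/ finite_set A.
Proof.
move=> fibG; rewrite -openC => openCA.
have [->|/setTPn[x nAx]] := eqVneq A setT; [by left | right].
have [C [finC monC Cx subC]] := open_monomial_basis openCA nAx.
have : finite_set (\bigcup_(V in C) ~` V).
  apply: bigcup_finite => // V CV.
  have : ~ (~` V) x by apply; exact: Cx.
  have /elementary_monomialP[n [y ->]] := monC V CV.
  by case: (fibG n y) => // -> /(_ I).
apply: sub_finite_set; rewrite -setC_bigcap => z Az Cz.
exact: subC Cz Az.
Qed.

Lemma Zmon_cofiniteP (G : groupType) :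
  Zmon_cofinite G <-> power_fibers_finite_or_full G.
Proof.
split=> [cofG n y | fibG A]; first exact/cofG/closed_power_fiber.
split=> [|[->|]]; [exact: closed_full_or_finite | exact: closedT |].
exact: finite_closed.
Qed.

(** A fiber that is the whole group contains [1], so it lies over [1]. *)
Lemma infinite_power_fiber (G : groupType) (n : nat) (y : G) :
  power_fibers_finite_or_full G -> infinite_set (power_fiber n y) ->
  forall x : G, x ^+ n = 1.
Proof.
move=> fibG infF; case: (fibG n y) => // fullF.
have yE (x : G) : x ^+ n = y by have : power_fiber n y x by rewrite fullF.
by move=> x; rewrite yE -(yE 1) expg1n.
Qed.

Lemma infinite_fiber (T U : Type) (f : T -> U) (B : set U) :
  infinite_set [set: T] -> finite_set B -> (forall x, B (f x)) ->
  exists2 y, B y & infinite_set (f @^-1` [set y]).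
Proof.
move=> infT finB fB; apply: contrapT => nfib; apply: infT.
have -> : [set: T] = \bigcup_(y in B) (f @^-1` [set y]).
  by apply/seteqP; split=> // x _; exists (f x).
apply: bigcup_finite => // y By; apply: contrapT => infy.
by apply: nfib; exists y.
Qed.

(** The group is covered by the fibers of [x |-> x ^+ a] over the solutions of
    [y ^+ b = 1], so it cannot be that both kinds of fibers are finite. *)
Lemma annihilating_factor (G : groupType) (a b : nat) :
  infinite_set [set: G] -> power_fibers_finite_or_full G ->
  (forall x : G, x ^+ (a * b) = 1) ->
  (forall x : G, x ^+ a = 1) \/ (forall x : G, x ^+ b = 1).
Proof.
move=> infG fibG abG.
have [finb|infb] := pselect (finite_set (power_fiber b (1 : G))); last first.
  by right; apply: infinite_power_fiber infb.
have ab1 (x : G) : power_fiber b 1 (x ^+ a).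
  by rewrite /power_fiber /= -expgnA.
have [y _ infy] := infinite_fiber infG finb ab1.
by left; apply: infinite_power_fiber infy.
Qed.

Lemma exponent_exists (G : groupType) (n : nat) :
  (0 < n)%N -> (forall x : G, x ^+ n = 1) -> exists m, is_exponent G m.
Proof.
move=> n_gt0 nG.
pose annihilates k := (0 < k)%N && `[< forall x : G, x ^+ k = 1 >].
have exk : exists k, annihilates k.
  by exists n; rewrite /annihilates n_gt0; apply/asboolP.
have [m /andP[m_gt0 /asboolP mG] min_m] := ex_minnP exk.
exists m; split=> // k k_gt0 kG; apply: min_m.
by rewrite /annihilates k_gt0; apply/asboolP.
Qed.

Lemma exponent_prime (G : groupType) (m : nat) :
  infinite_set [set: G] -> power_fibers_finite_or_full G ->
  is_exponent G m -> prime m.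
Proof.
move=> infG fibG [m_gt0 mG min_m].
have m_gt1 : (1 < m)%N.
  rewrite ltn_neqAle m_gt0 andbT; apply/eqP => m1; apply: infG.
  suff -> : [set: G] = [set 1] by exact: finite_set1.
  by apply/seteqP; split=> // x _ /=; rewrite -(mG x) -m1.
apply: contraT => /primePn[|[a /andP[a_gt1 a_lt] /dvdnP[b mE]]].
  by rewrite ltnNge m_gt1.
have a_gt0 := ltnW a_gt1.
have b_gt0 : (0 < b)%N by move: m_gt0; rewrite mE muln_gt0 => /andP[].
have b_lt : (b < m)%N by rewrite mE ltn_Pmulr.
have baG (x : G) : x ^+ (b * a) = 1 by rewrite -mE.
have [/(min_m b b_gt0)|/(min_m a a_gt0)] :=
  annihilating_factor infG fibG baG.
  by rewrite leqNgt b_lt.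
by rewrite leqNgt a_lt.
Qed.

Lemma prime_exponent_power_fibers (G : groupType) :
  prime_exponent G -> power_fibers_finite_or_full G.
Proof.
move=> [p [p_gt0 pG _] p_prime] n y.
have mulpG (x : G) k : x ^+ (k * p) = 1 by rewrite mulnC expgnA pG expg1n.
have [/dvdnP[k ->]|p_ndvd] := boolP (p %| n)%N.
  have [<-|y_neq1] := eqVneq 1 y.
    by left; apply/seteqP; split=> // x _; apply: mulpG.
  right; apply: sub_finite_set (finite_set0 G) => x.
  by rewrite /power_fiber /= mulpG => /eqP; rewrite (negPf y_neq1).
right; have n_gt0 : (0 < n)%N by rewrite lt0n; apply: contraNneq p_ndvd => ->.
(* By Bezout, [u] inverts [n] modulo [p], so [x ^+ n] determines [x]. *)
have [u v bezout _] := egcdnP p n_gt0.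
have invG (x : G) : x = x ^+ n ^+ u.
  rewrite -expgnA mulnC bezout expgnDr mulpG mul1g.
  by move: p_ndvd; rewrite -prime_coprime // coprime_sym => /eqP ->; rewrite expg1.
apply: sub_finite_set (finite_set1 (y ^+ u)) => x xny.
by rewrite /= (invG x) xny.
Qed.

Lemma WCL_power_fibers (G : groupType) :
  WCL G -> power_fibers_finite_or_full G.
Proof.
move=> wclG [|n] y; last by right; apply: wclG.
have [<-|y_neq1] := eqVneq 1 y.
  by left; apply/seteqP; split=> // x _; apply: expg0.
right; apply: sub_finite_set (finite_set0 G) => x.
by rewrite /power_fiber /= expg0 => /eqP; rewrite (negPf y_neq1).
Qed.

Theorem theorem2p6 (G : groupType) (infG : infinite_set [set: G]) :
  Zmon_cofinite G <-> prime_exponent G \/ WCL G.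
Proof.
rewrite Zmon_cofiniteP; split; last first.
  by case; [apply: prime_exponent_power_fibers | apply: WCL_power_fibers].
move=> fibG; have [|nWCL] := pselect (WCL G); [by right | left].
have [n [n_gt0 [y infF]]] :
    exists n, (0 < n)%N /\ exists y : G, infinite_set (power_fiber n y).
  apply: contrapT => noF; apply: nWCL => n n_gt0 y.
  by apply: contrapT => infF; apply: noF; exists n; split=> //; exists y.
have nG := infinite_power_fiber fibG infF.
have [m expm] := exponent_exists n_gt0 nG.
by exists m => //; apply: exponent_prime expm.
Qed.
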